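(* Let $\{1\to H_i\to\Gamma_i\to G_i\to 1\}_{i\in\mathbb{N}}$ be a sequence of extensions of finite groups, such that the number of elements required to generate the groups $\Gamma_i$ is uniformly bounded over $i\in\mathbb{N}$, and each $\Gamma_i$ is equipped with the word metric from a finite generating set, these generating sets being of uniformly bounded cardinality. Suppose that the diameters of the $\Gamma_i$ increase strictly with $i$. Let $(\sqcup\Gamma_i,d_\Gamma)$, $(\sqcup H_i,d_H)$ and $(\sqcup G_i,d_G)$ be the associated metric spaces (defined in the context). If $(\sqcup H_i,d_H)$ embeds coarsely into Hilbert space and $(\sqcup G_i,d_G)$ has property A, then $(\sqcup\Gamma_i,d_\Gamma)$ embeds coarsely into Hilbert space.
   Context: The metric $d_\Gamma$ on the disjoint union $\sqcup\Gamma_i$: on each $\Gamma_i$ it is the word metric; the distance $d_\Gamma(e_i,e_{i+1})$ between the identity elements of consecutive components is chosen greater than the largest of the diameters of $\Gamma_i$ and $\Gamma_{i+1}$; and for $\alpha\in\Gamma_i$, $\beta\in\Gamma_j$ with $i<j$, $d_\Gamma(\alpha,\beta)=d_\Gamma(\alpha,e_i)+\sum_{k=i}^{j-1}d_\Gamma(e_k,e_{k+1})+d_\Gamma(e_j,\beta)$. The metric $d_H$ on $\sqcup H_i$ is the restriction of $d_\Gamma$ (viewing $H_i\le\Gamma_i$). The metric $d_G$ on $\sqcup G_i$: on each $G_i\cong\Gamma_i/H_i$ it is the quotient metric induced from the word metric of $\Gamma_i$; the distance between the identity elements of the consecutive components $G_k$ and $G_{k+1}$ equals that between $\Gamma_k$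 and $\Gamma_{k+1}$ (namely $d_\Gamma(e_k,e_{k+1})$), and distances between points of different components are given by the same formula through identity elements. Coarse embedding: a metric space $(X,d_X)$ embeds coarsely in $(Y,d_Y)$ if there are a map $F:X\to Y$ and non-decreasing functions $\rho_\pm:\mathbb{R}_+\to\mathbb{R}_+$ with $\lim_{t\to\infty}\rho_\pm(t)=\infty$ and $\rho_-(d_X(x,x'))\le d_Y(F(x),F(x'))\le \rho_+(d_X(x,x'))$ for all $x,x'\in X$. Property A: a discrete metric space $(X,d)$ with bounded geometry has property A if for every $R>0$ and $\varepsilon>0$ there exist $S>0$ and a function $\phi:X\to\ell^2(X)$ with $\|\phi(x)\|=1$ for all $x\in X$ such that (1) $d(x_1,x_2)\le R$ implies $|1-\langle\phi(x_1),\phi(x_2)\rangle|\le\varepsilon$, and (2) $\operatorname{Supp}\phi(x)\subset B_S(x)$ for all $x\in X$. *)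

(* Defs.v *)
(* MathComp / MathComp-Analysis *)
From HB Require Import structures.
From mathcomp Require Import all_boot all_order all_fingroup all_algebra.
From mathcomp Require Import all_classical all_reals all_analysis.

Set Implicit Arguments.
Unset Strict Implicit.
Unset Printing Implicit Defensive.
Import Order.TTheory GRing.Theory Num.Theory.
Import numFieldNormedType.Exports.

Local Open Scope ring_scope.

Definition short_exact (hT gT qT : finGroupType)
    (iota : {morphism [set: hT] >-> gT}) (pi : {morphism [set: gT] >-> qT}) :
    Prop :=
  [/\ ('injm iota)%g, (iota @* [set: hT] = 'ker pi)%g
    & (pi @* [set: gT] = [set: qT])%g].

Section WordMetric.
Variables (gT : finGroupType) (S : {set gT}).

(* [A ^+ n] is the set of all products of [n] elements of [A].  The guard only
   makes [word_length] total: it holds for every [g] when [S] generates. *)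
Definition word_reach (g : gT) (n : nat) : bool :=
  (g \in <<S>>)%g ==> (g \in (S :|: S^-1) ^+ n)%g.

Lemma word_reachP (g : gT) : exists n, word_reach g n.
Proof.
rewrite /word_reach; case: (boolP (g \in <<S>>)%g) => [/gen_prodgP|_]; last first.
  by exists 0%N.
move=> [n [c cS ->]]; exists n => /=.
rewrite -[n in X in _ \in X]card_ord -prodg_const.
apply/prodsgP; exists c => // i _.
by rewrite inE cS.
Qed.

Definition word_length (g : gT) : nat := ex_minn (word_reachP g).

Definition word_dist (a b : gT) : nat := word_length (a^-1 * b)%g.

Definition word_diam : nat := \max_(a : gT) \max_(b : gT) word_dist a b.

End WordMetric.

Local Open Scope classical_set_scope.

Section Metrics.
Variable R : realType.

(* Distance between fibres; for a word metric and a surjective homomorphism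
   this infimum is attained and is the quotient metric. *)
Definition quotient_dist (X Y : Type) (p : X -> Y) (d : X -> X -> R)
    (y y' : Y) : R :=
  inf [set r | exists x x', [/\ p x = y, p x' = y' & r = d x x']].

(* [c k] is the distance between the base points of components [k] and
   [k.+1]. *)
Definition union_dist (X : nat -> Type) (e : forall i, X i)
    (d : forall i, X i -> X i -> R) (c : nat -> R) (u v : {i & X i}) : R :=
  let i := tag u in let j := tag v in
  if i == j then d i (tagged u) (tagged_as u v)
  else if (i < j)%N then
    d i (tagged u) (e i) + \sum_(i <= k < j) c k + d j (e j) (tagged v)
  else
    d j (tagged v) (e j) + \sum_(j <= k < i) c k + d i (e i) (tagged u).

Definition coarse_embedding (X Y : Type) (dX : X -> X -> R) (dY : Y -> Y -> R)
    (F : X -> Y) : Prop :=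
  exists rho_m rho_p : R -> R,
    [/\ forall rho, rho = rho_m \/ rho = rho_p ->
          [/\ forall t : R, 0 <= t -> 0 <= rho t,
              forall s t : R, 0 <= s -> s <= t -> rho s <= rho t
            & rho t @[t --> +oo] --> +oo]
      & forall x x', rho_m (dX x x') <= dY (F x) (F x') <= rho_p (dX x x')].

(* A Banach space whose norm comes from an inner product. *)
Definition is_hilbert (V : completeNormedModType R) : Prop :=
  exists ip : {dot V for idfun}, forall x : V, `|x| ^+ 2 = ip x x.

Definition embeds_coarsely_in_hilbert (X : Type) (d : X -> X -> R) : Prop :=
  exists (V : completeNormedModType R) (F : X -> V),
    is_hilbert V /\ coarse_embedding d (fun v w : V => `|v - w|) F.

Definition bounded_geometry (X : choiceType) (d : X -> X -> R) : Prop :=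
  forall r : R, exists N : nat, forall x : X,
    exists A : seq X, (size A <= N)%N /\ forall y, d x y <= r -> y \in A.

Section Ell2.
Variable X : choiceType.

Definition square_summable (f : X -> R) : Prop :=
  summable [set: X] (fun z => (f z ^+ 2)%:E).

(* [esum] is only meant for nonnegative families, hence the splitting. *)
Definition ell2_dot (f g : X -> R) : R :=
  let h := fun z => (f z * g z)%:E in
  fine (esum [set: X] h^\+ - esum [set: X] h^\-)%E.

Definition ell2_norm (f : X -> R) : R := Num.sqrt (ell2_dot f f).

End Ell2.

(* Discreteness is implied by bounded geometry: all balls are finite. *)
Definition property_A (X : choiceType) (d : X -> X -> R) : Prop :=
  bounded_geometry d /\
  forall r eps : R, 0 < r -> 0 < eps ->
  exists (S : R) (phi : X -> X -> R),
    [/\ 0 < S,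
        forall x, square_summable (phi x) /\ ell2_norm (phi x) = 1,
        forall x1 x2, d x1 x2 <= r ->
          `|1 - ell2_dot (phi x1) (phi x2)| <= eps
      & forall x z, phi x z != 0 -> d x z <= S].

Section BoxSpaces.
Variables (H Gam G : nat -> finGroupType).
Variables (iota : forall i, {morphism [set: H i]%SET >-> Gam i}).
Variables (pi : forall i, {morphism [set: Gam i]%SET >-> G i}).
Variables (S : forall i, {set Gam i}) (c : nat -> R).

Definition word_distR (i : nat) (a b : Gam i) : R := (word_dist (S i) a b)%:R.

Definition dGam : {i & Gam i} -> {i & Gam i} -> R :=
  union_dist (fun i => 1%g : Gam i) word_distR c.

Definition dH (u v : {i & H i}) : R :=
  dGam (Tagged Gam (iota (tag u) (tagged u)))
       (Tagged Gam (iota (tag v) (tagged v))).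

Definition dG : {i & G i} -> {i & G i} -> R :=
  union_dist (fun i => 1%g : G i)
    (fun i => quotient_dist (pi i) (@word_distR i)) c.

End BoxSpaces.

End Metrics.

(* Main.v *)
Require Import Defs.
From HB Require Import structures.
From mathcomp Require Import all_boot all_order all_fingroup all_algebra.
From mathcomp Require Import all_classical all_reals all_analysis.
From mathcomp Require Import ring lra.

Set Implicit Arguments.
Unset Strict Implicit.
Unset Printing Implicit Defensive.
Import Order.TTheory GRing.Theory Num.Theory.
Import numFieldNormedType.Exports.
Local Open Scope ring_scope.

(** Throughout, Gamma, H and G also stand for the disjoint unions of the three
    families of groups.

    Hilbert space enters only through positive semidefinite kernels.  A
    countable metric space embeds coarsely as soon as, for every radius and every tolerance, it
    carries a normalized positive semidefinite kernel which is close to 1 on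
    pairs within that radius and at most 1/2 on pairs far enough apart
    ([kernels_coarse_embedding]): for such kernels k_n, of radius n and
    tolerance 2^-n, the sum of the defects 1 - k_n is the square of the
    distance between the images of the points under a map to l^2, because
    every positive semidefinite kernel on a countable set is a Gram kernel, by
    Cholesky factorisation ([psd_realize]).  Conversely a coarse embedding F
    provides such kernels, namely the Gaussians exp(- t |F x - F y|^2)
    ([psd_gaussian], [fibre_kernel]).

    To produce kernels on Gamma, write p for the projection to G.  For a point
    u of Gamma and a point y of G choose a point eta u y of the fibre over y
    almost nearest to u.  A fibre over the j-th component is a coset of H_j,
    and left translation, which is isometric, identifies it with H_j; this
    turns eta u y into a point th u y of H.  If phi is given by property A for
    G and kH is a Gaussian kernel on H, then

      K u v = sum over y of phi (p u) y * phi (p v) y * kH (th u y) (th v y)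

    is positive semidefinite and normalized.  Only the y within S of both p u
    and p v contribute, and for these y the points eta u y and eta v y are as
    far apart as u and v up to a constant depending on S.  Hence K is close to
    1 for u and v close, since both phi and kH are, and at most 1/2 for u and
    v far apart, since every contributing kH is ([total_kernel]).

    The argument needs that the distance from u to the fibre over y is bounded
    in terms of d(p u, y), also when y lies in another component.  There the distance in Gamma
    involves the length of u, while the distance in G involves only the length
    of p u; but the length of u is at most the diameter of its component,
    which the gap between components exceeds, so that a factor 2 is enough
    ([box_near_fibre]). *)

(** * The Hilbert space of square-summable sequences *)

Section HilbertSequences.
Local Open Scope classical_set_scope.
Variable R : realType.
Implicit Types f g : nat -> R.

Definition sq_sum f (n : nat) : R := \sum_(i < n) f i ^+ 2.

Lemma sq_sum_nondecreasing f : nondecreasing_seq (sq_sum f).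
Proof.
move=> m n mn; rewrite /sq_sum -!(big_mkord predT (fun i => f i ^+ 2)).
rewrite [leRHS](big_cat_nat (n := m))//= lerDl.
by apply: sumr_ge0 => i _; rewrite sqr_ge0.
Qed.

Lemma cvg_finite_sum (T : Type) (F : set_system T) (n : nat)
    (f : 'I_n -> T -> R) (l : 'I_n -> R) : Filter F ->
  (forall i, f i x @[x --> F] --> l i) ->
  \sum_(i < n) f i x @[x --> F] --> \sum_(i < n) l i.
Proof. by move=> FF fl; apply: cvg_big => // x; exact: add_continuous. Qed.

Definition is_sq_summable : {pred nat -> R} :=
  fun f => `[< exists M, forall n, sq_sum f n <= M >].

Lemma sq_summableP f :
  reflect (exists M, forall n, sq_sum f n <= M) (f \in is_sq_summable).
Proof. exact: asboolP. Qed.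

Lemma sq_summable_submod_closed : submod_closed is_sq_summable.
Proof.
split=> [|a f g /sq_summableP[Mf fM] /sq_summableP[Mg gM]].
  apply/sq_summableP; exists 0 => n.
  by rewrite /sq_sum big1// => i _; rewrite expr0n.
apply/sq_summableP; exists (2 * a ^+ 2 * Mf + 2 * Mg) => n.
apply: (@le_trans _ _ (2 * a ^+ 2 * sq_sum f n + 2 * sq_sum g n)).
  rewrite /sq_sum !mulr_sumr -big_split /=; apply: ler_sum => i _.
  have -> : (a *: f + g) i = a * f i + g i by [].
  have := sqr_ge0 (a * f i - g i); nra.
by apply: lerD; apply: ler_wpM2l => //; apply: mulr_ge0 => //; exact: sqr_ge0.
Qed.

HB.instance Definition _ :=
  GRing.isSubmodClosed.Build R (nat -> R) is_sq_summable
    sq_summable_submod_closed.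

Record hilbert_seq := HilbertSeq {
  hval :> nat -> R;
  hvalP : hval \in is_sq_summable }.

HB.instance Definition _ := [isSub for hval].
HB.instance Definition _ := [Choice of hilbert_seq by <:].
HB.instance Definition _ := [SubChoice_isSubLmodule of hilbert_seq by <:].

Implicit Types u v w : hilbert_seq.

Lemma hvalD u v i : hval (u + v) i = u i + v i. Proof. by []. Qed.
Lemma hvalB u v i : hval (u - v) i = u i - v i. Proof. by []. Qed.
Lemma hvalZ a u i : hval (a *: u) i = a * u i. Proof. by []. Qed.

Definition hdot u v : R := limn (fun n => \sum_(i < n) u i * v i).

Lemma is_cvg_sq_sum u : cvgn (sq_sum u).
Proof.
have /sq_summableP[M uM] := hvalP u.
apply: nondecreasing_is_cvgn; first exact: sq_sum_nondecreasing.
by exists M => _ [n _ <-].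
Qed.

(** Polarization reduces the convergence of the mixed sums to that of the
    monotone and bounded sums of squares. *)
Lemma hdot_cvg u v : (fun n => \sum_(i < n) u i * v i) @ \oo --> hdot u v.
Proof.
have E : (fun n => \sum_(i < n) u i * v i) = (fun n =>
    2^-1 * (sq_sum (u + v : hilbert_seq) n - (sq_sum u n + sq_sum v n))).
  apply/funext => n; rewrite /sq_sum -big_split -sumrB mulr_sumr.
  by apply: eq_bigr => i _; rewrite hvalD /=; field.
suff h : cvgn (fun n => \sum_(i < n) u i * v i) by exact: h.
rewrite E; apply: is_cvgMr; apply: is_cvgB; first exact: is_cvg_sq_sum.
by apply: is_cvgD; exact: is_cvg_sq_sum.
Qed.

Lemma hdotC u v : hdot u v = hdot v u.
Proof.
rewrite /hdot; congr (limn _); apply/funext => n.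
by apply: eq_bigr => i _; rewrite mulrC.
Qed.

Lemma hdot_linear v : scalar (hdot^~ v).
Proof.
move=> a u w; rewrite /= {1}/hdot; apply/cvg_lim => //.
have -> : (fun n => \sum_(i < n) hval (a *: u + w) i * v i) =
  (fun n => a * (\sum_(i < n) u i * v i) + \sum_(i < n) w i * v i).
  apply/funext => n; rewrite mulr_sumr -big_split; apply: eq_bigr => i _.
  by rewrite hvalD hvalZ mulrDl mulrA.
by apply: cvgD; [apply: cvgMr|]; exact: hdot_cvg.
Qed.

Lemma sq_sum_le_hdot u n : sq_sum u n <= hdot u u.
Proof.
exact: (nondecreasing_cvgn_le (sq_sum_nondecreasing u) (@hdot_cvg u u)).
Qed.

Lemma hdot_ge0 u : 0 <= hdot u u.
Proof. by have := sq_sum_le_hdot u 0; rewrite /sq_sum big_ord0. Qed.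

Lemma hdot_eq0 u : hdot u u = 0 -> u = 0.
Proof.
move=> u0; apply/val_inj/funext => n /=.
have := sq_sum_le_hdot u n.+1; rewrite u0 /sq_sum big_ord_recr/= => un.
apply/eqP; rewrite -sqrf_eq0 eq_le sqr_ge0 andbT.
apply: le_trans un; rewrite lerDr.
by apply: sumr_ge0 => i _; rewrite sqr_ge0.
Qed.

Definition hnorm u : R := Num.sqrt (hdot u u).

Lemma sqr_hnorm u : hnorm u ^+ 2 = hdot u u.
Proof. by rewrite sqr_sqrtr// hdot_ge0. Qed.

Lemma hdotDl u v w : hdot (u + v) w = hdot u w + hdot v w.
Proof. by have := hdot_linear w 1 u v; rewrite scale1r mul1r. Qed.

Lemma hdotZl a u w : hdot (a *: u) w = a * hdot u w.
Proof.
have h0 : hdot 0 w = 0 by have := hdotDl 0 0 w; rewrite addr0; lra.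
by have := hdot_linear w a u 0; rewrite !addr0 h0 addr0.
Qed.

Lemma hdotDr u v w : hdot w (u + v) = hdot w u + hdot w v.
Proof. by rewrite hdotC hdotDl !(hdotC w). Qed.

Lemma hdotZr a u w : hdot w (a *: u) = a * hdot w u.
Proof. by rewrite hdotC hdotZl (hdotC w). Qed.

Lemma hdot_le_norm u v : hdot u v <= hnorm u * hnorm v.
Proof.
have a0 : 0 <= hnorm u := sqrtr_ge0 _.
have b0 : 0 <= hnorm v := sqrtr_ge0 _.
have hN0 w : hnorm w = 0 -> w = 0.
  by move=> w0; apply: hdot_eq0; rewrite -sqr_hnorm w0 expr0n.
have z0 w : hdot 0 w = 0 by have := hdotZl 0 0 w; rewrite scale0r mul0r.
have [/hN0 ->|un0] := eqVneq (hnorm u) 0.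
  by rewrite z0 mulr_ge0 ?sqrtr_ge0.
have [/hN0 ->|vn0] := eqVneq (hnorm v) 0.
  by rewrite hdotC z0 mulr_ge0 ?sqrtr_ge0.
(* the squared norm of |v| u - |u| v equals 2 |u| |v| (|u| |v| - <u, v>) *)
have := hdot_ge0 (hnorm v *: u + (- hnorm u) *: v).
rewrite !(hdotDl, hdotDr, hdotZl, hdotZr) (hdotC v u) -!sqr_hnorm.
move: un0 vn0 a0 b0; set a := hnorm u; set b := hnorm v; set c := hdot u v.
move=> an0 bn0 a0 b0 h.
have ab : 0 < a * b by rewrite mulr_gt0// lt_neqAle eq_sym ?an0 ?bn0.
rewrite -(ler_pM2l ab); nra.
Qed.

Lemma hnormD u v : hnorm (u + v) <= hnorm u + hnorm v.
Proof.
rewrite -(@ler_pXn2r _ 2)// ?nnegrE ?addr_ge0 ?sqrtr_ge0//.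
rewrite sqr_hnorm !(hdotDl, hdotDr) (hdotC v u) -!sqr_hnorm.
by have := hdot_le_norm u v; lra.
Qed.

Lemma hnormZ a u : hnorm (a *: u) = `|a| * hnorm u.
Proof.
by rewrite /hnorm hdotZl hdotZr mulrA -expr2 sqrtrM ?sqr_ge0// sqrtr_sqr.
Qed.

Lemma hnorm_eq0 u : hnorm u = 0 -> u = 0.
Proof. by move=> u0; apply: hdot_eq0; rewrite -sqr_hnorm u0 expr0n. Qed.

HB.instance Definition _ :=
  Lmodule_isNormed.Build R hilbert_seq hnormD hnormZ hnorm_eq0.

Lemma sq_sum_le_norm u n : sq_sum u n <= `|u| ^+ 2.
Proof. by rewrite sqr_hnorm; exact: sq_sum_le_hdot. Qed.

Lemma norm_le_sq_sum u (M : R) :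
  0 <= M -> (forall n, sq_sum u n <= M ^+ 2) -> `|u| <= M.
Proof.
move=> M0 uM; rewrite -(@ler_pXn2r _ 2)// ?nnegrE// sqr_hnorm.
apply: (cvgr_to_le (@hdot_cvg u u)).
by apply: nearW => n; exact: uM.
Qed.

Lemma coord_le_norm u i : `|u i| <= `|u|.
Proof.
rewrite -(@ler_pXn2r _ 2)// ?nnegrE// real_normK ?num_real//.
apply: le_trans (sq_sum_le_norm u i.+1).
rewrite /sq_sum big_ord_recr/= lerDr.
by apply: sumr_ge0 => j _; rewrite sqr_ge0.
Qed.

(** The limit is taken coordinatewise.  Square sums over finitely many
    coordinates pass to this limit, so that a bound on them that is uniform in
    the number of coordinates gives convergence in norm. *)
Lemma hilbert_seq_complete (F : set_system hilbert_seq) :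
  ProperFilter F -> cauchy F -> cvg F.
Proof.
move=> FF Fc.
have Fball (e : R) : 0 < e -> exists x, F (ball x e).
  by move=> e0; move/cauchyP : Fc => /(_ _ e0).
have coordP i : cvg ((fun u : hilbert_seq => u i) @ F).
  apply: cauchy_cvg; apply/cauchyP => e e0.
  have [x Fx] := Fball _ e0; exists (x i).
  rewrite /fmap /=; apply: filterS Fx => u; rewrite -!ball_normE/= => xu.
  by apply: le_lt_trans xu; rewrite -hvalB; exact: coord_le_norm.
pose l i := lim ((fun u : hilbert_seq => u i) @ F).
have near_l (e : R) x n : 0 < e -> F (ball x e) ->
    sq_sum (fun i => x i - l i) n <= e ^+ 2.
  move=> e0 Fx.
  have cv : (fun u : hilbert_seq => sq_sum (hval (x - u)) n) @ F -->
      sq_sum (fun i => x i - l i) n.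
    rewrite /sq_sum; apply: cvg_finite_sum => i.
    rewrite expr2; under eq_cvg do rewrite hvalB expr2.
    by apply: cvgM; apply: cvgB => //; exact: cvg_cst.
  apply: (cvgr_to_le cv); apply: filterS Fx => u; rewrite -ball_normE/= => xu.
  apply: (le_trans (sq_sum_le_norm (x - u) n)).
  by rewrite ler_pXn2r ?nnegrE// ltW.
have [x1 Fx1] := Fball 1 ltr01.
have dP : (fun i => x1 i - l i) \in is_sq_summable.
  by apply/sq_summableP; exists (1 ^+ 2) => n; exact: near_l.
pose L := x1 - HilbertSeq dP.
have L_l i : L i = l i by rewrite hvalB /= subKr.
apply/cvg_ex; exists L; apply/cvgrPdist_le => e e0.
have e20 : 0 < e / 2 by rewrite divr_gt0.
have [x Fx] := Fball _ e20.
have xL : `|x - L| <= e / 2.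
  apply: norm_le_sq_sum; first exact: ltW.
  move=> n; rewrite (_ : sq_sum _ _ = sq_sum (fun i => x i - l i) n).
    exact: near_l.
  by apply: eq_bigr => i _; rewrite hvalB L_l.
apply: filterS Fx => u; rewrite -ball_normE/= => xu.
have -> : L - u = (x - u) - (x - L) by rewrite opprB [RHS]addrC addrA subrK.
by apply: (le_trans (ler_normB _ _)); lra.
Qed.

HB.instance Definition _ :=
  Uniform_isComplete.Build hilbert_seq hilbert_seq_complete.

Let hdot_bilinear : bilinear_for *%R (idfun \; *%R) hdot.
Proof.
split=> [v a u w|u a v w]; first exact: hdot_linear.
by rewrite hdotDr hdotZr.
Qed.

HB.instance Definition _ :=
  bilinear_isBilinear.Build R hilbert_seq hilbert_seq R *%R (idfun \; *%R) hdot
    hdot_bilinear.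

Let hdot_sym u v : hdot u v = (-1) ^+ false * idfun (hdot v u).
Proof. by rewrite expr0 mul1r /= hdotC. Qed.

HB.instance Definition _ :=
  isHermitianSesquilinear.Build R hilbert_seq false idfun hdot hdot_sym.

Let hdot_gt0 u : u != 0 -> 0 < hdot u u.
Proof.
move=> u0; rewrite lt_neqAle hdot_ge0 andbT eq_sym.
by apply: contra_neq u0 => /hdot_eq0.
Qed.

HB.instance Definition _ := isDotProduct.Build R hilbert_seq hdot hdot_gt0.

Lemma hilbert_seq_hilbert : is_hilbert (hilbert_seq : completeNormedModType R).
Proof.
by exists (hdot : {dot hilbert_seq for idfun}) => u; exact: sqr_hnorm.
Qed.

End HilbertSequences.

(** * Positive semidefinite kernels *)

Section PositiveKernels.
Local Open Scope classical_set_scope.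
Variable R : realType.

(** Points and weights are given by functions on [nat], of which only the first
    [n] values count, so that a finite family of points pulls a kernel back to
    a kernel on [nat], where the Cholesky factorisation applies. *)
Definition quad_form (T : Type) (K : T -> T -> R) n (x : nat -> T)
    (a : nat -> R) : R :=
  \sum_(i < n) \sum_(j < n) a i * a j * K (x i) (x j).

Definition psd (T : Type) (K : T -> T -> R) : Prop :=
  (forall x y, K x y = K y x) /\ forall n x a, 0 <= quad_form K n x a.

Lemma psd_comp (S T : Type) (f : S -> T) (K : T -> T -> R) :
  psd K -> psd (fun x y => K (f x) (f y)).
Proof.
move=> [Ks Kp]; split=> [x y|n x a]; first exact: Ks.
exact: (Kp n (f \o x) a).
Qed.

Lemma psd_weight (T : Type) (f : T -> R) (K : T -> T -> R) :
  psd K -> psd (fun x y => f x * f y * K x y).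
Proof.
move=> [Ks Kp]; split=> [x y|n x a]; first by rewrite Ks (mulrC (f x)).
suff -> : quad_form (fun x y => f x * f y * K x y) n x a =
  quad_form K n x (fun i => a i * f (x i)) by [].
by apply: eq_bigr => i _; apply: eq_bigr => j _; ring.
Qed.

Lemma psd_cst1 (T : Type) : psd (fun _ _ : T => 1).
Proof.
split=> // n x a; suff -> : quad_form (fun=> fun=> 1) n x a =
  (\sum_(i < n) a i) ^+ 2 by exact: sqr_ge0.
rewrite /quad_form expr2 mulr_suml; apply: eq_bigr => i _.
by rewrite mulr_sumr; apply: eq_bigr => j _; rewrite mulr1.
Qed.

Lemma psd_scale (T : Type) (c : R) (K : T -> T -> R) :
  0 <= c -> psd K -> psd (fun x y => c * K x y).
Proof.
move=> c0 /(psd_weight (fun=> Num.sqrt c)).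
by under eq_fun do under eq_fun do rewrite -expr2 sqr_sqrtr//.
Qed.

Lemma psd_sum (T I : Type) (s : seq I) (K : I -> T -> T -> R) :
  (forall i, psd (K i)) -> psd (fun x y => \sum_(i <- s) K i x y).
Proof.
move=> Kpsd; split=> [x y|n x a].
  by apply: eq_bigr => i _; rewrite (Kpsd i).1.
have -> : quad_form (fun x y => \sum_(i <- s) K i x y) n x a =
    \sum_(i <- s) quad_form (K i) n x a.
  rewrite exchange_big; apply: eq_bigr => i _.
  rewrite exchange_big; apply: eq_bigr => j _.
  by rewrite mulr_sumr.
by apply: sumr_ge0 => i _; exact: (Kpsd i).2.
Qed.

Lemma psd_lim (T : Type) (K_ : nat -> T -> T -> R) (K : T -> T -> R) :
  (forall n, psd (K_ n)) -> (forall x y, (fun n => K_ n x y) @ \oo --> K x y) ->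
  psd K.
Proof.
move=> Kpsd Kcvg; split=> [x y|n x a].
  apply: (cvg_unique _ (Kcvg x y)) => //.
  have -> : (fun n => K_ n x y) = (fun n => K_ n y x).
    by apply/funext => n; exact: (Kpsd n).1.
  exact: Kcvg.
have cv : (fun m => quad_form (K_ m) n x a) @ \oo --> quad_form K n x a.
  apply: cvg_finite_sum => i; apply: cvg_finite_sum => j.
  by apply: cvgM; [exact: cvg_cst|exact: Kcvg].
by apply: (cvgr_to_ge cv); apply: nearW => m; exact: (Kpsd m).2.
Qed.

(** This is the quadratic form of [n.+1] points, the last one being [p] with
    weight [b]; choosing [b] well is what yields the consequences of
    positivity below. *)
Lemma quad_form_rcons (T : Type) (K : T -> T -> R) n (x : nat -> T)
    (a : nat -> R) (p : T) (b : R) : psd K ->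
  0 <= quad_form K n x a + 2 * b * (\sum_(i < n) a i * K (x i) p) +
       b ^+ 2 * K p p.
Proof.
move=> [Ks Kp].
pose x' i := if (i < n)%N then x i else p.
pose a' i := if (i < n)%N then a i else b.
have [x'n a'n] : x' n = p /\ a' n = b by rewrite /x' /a' ltnn.
have x'i (i : 'I_n) : x' i = x i by rewrite /x' ltn_ord.
have a'i (i : 'I_n) : a' i = a i by rewrite /a' ltn_ord.
have -> : quad_form K n x a + 2 * b * (\sum_(i < n) a i * K (x i) p) +
    b ^+ 2 * K p p = quad_form K n.+1 x' a'; last exact: Kp.
rewrite /quad_form big_ord_recr/= big_ord_recr/= x'n a'n.
under [in RHS]eq_bigr => i _ do rewrite big_ord_recr/= x'n a'n x'i a'i.
rewrite big_split/= -!addrA; congr (_ + _).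
  by apply: eq_bigr => i _; apply: eq_bigr => j _; rewrite x'i a'i.
rewrite [RHS]addrA; congr (_ + _).
rewrite -big_split mulr_sumr; apply: eq_bigr => i _ /=.
by rewrite x'i a'i (Ks p); ring.
Qed.

Lemma psd_diag_ge0 (T : Type) (K : T -> T -> R) p : psd K -> 0 <= K p p.
Proof.
move=> Kp; have := quad_form_rcons 0 (fun=> p) (fun=> 0) p 1 Kp.
by rewrite /quad_form !big_ord0 mulr0 !add0r expr1n mul1r.
Qed.

Lemma psd_diag_eq0 (T : Type) (K : T -> T -> R) p x :
  psd K -> K p p = 0 -> K x p = 0.
Proof.
move=> Kp p0; have h t := quad_form_rcons 1 (fun=> x) (fun=> 1) p t Kp.
rewrite /quad_form in h.
have {}h t : 0 <= K x x + 2 * t * K x p.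
  by have := h t; rewrite !big_ord1 p0 !mul1r mulr0 addr0.
have [//|Kn0] := eqVneq (K x p) 0.
have := h (- (K x x + 1) / (2 * K x p)).
have -> : 2 * (- (K x x + 1) / (2 * K x p)) * K x p = - (K x x + 1) by field.
lra.
Qed.

(** The value of the new quadratic form is the minimum over [b] of
    [quad_form_rcons].  When [K p p] vanishes, so does the division by it, and
    the kernel is unchanged. *)
Lemma psd_schur_complement (T : Type) (K : T -> T -> R) p :
  psd K -> psd (fun x y => K x y - K x p * K y p / K p p).
Proof.
move=> Kp; split=> [x y|n x a]; first by rewrite Kp.1 (mulrC (K x p)).
set s := \sum_(i < n) a i * K (x i) p.
have -> : quad_form (fun x y => K x y - K x p * K y p / K p p) n x a =
    quad_form K n x a - s ^+ 2 / K p p.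
  rewrite expr2 mulr_suml mulr_suml -sumrB; apply: eq_bigr => i _.
  rewrite mulr_sumr mulr_suml -sumrB; apply: eq_bigr => j _; ring.
have := quad_form_rcons n x a p (- s / K p p) Kp; rewrite -/s.
have [p0|pn0] := eqVneq (K p p) 0.
  by rewrite p0 invr0 !mulr0 !mul0r addr0 subr0 addr0.
congr (_ <= _); field => //.
Qed.

(** * Cholesky factorisation and Gram kernels *)

(** What remains of a kernel on [nat] after eliminating the points
    [0, ..., m - 1]. *)
Fixpoint residual (K : nat -> nat -> R) (m : nat) : nat -> nat -> R :=
  if m is m'.+1 then
    fun i j => residual K m' i j -
      residual K m' i m' * residual K m' j m' / residual K m' m' m'
  else K.

Definition cholesky (K : nat -> nat -> R) (i m : nat) : R :=
  residual K m i m / Num.sqrt (residual K m m m).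

Lemma residual_psd K m : psd K -> psd (residual K m).
Proof. by move=> Kp; elim: m => //= m; exact: psd_schur_complement. Qed.

Lemma residual_eq0 K n m i : psd K -> (m < n)%N -> residual K n i m = 0.
Proof.
move=> Kp; elim: n i => // n IH i.
rewrite ltnS leq_eqVlt => /orP[/eqP ->|mn] /=.
  have Kn := residual_psd n Kp.
  have [n0|nn0] := eqVneq (residual K n n n) 0.
    by rewrite (psd_diag_eq0 i Kn n0) !mul0r subr0.
  by rewrite mulfK// subrr.
by rewrite IH// [residual K n m n](residual_psd n Kp).1 IH// mulr0 mul0r subr0.
Qed.

Lemma choleskyE K n i j : psd K -> (j < n)%N ->
  K i j = \sum_(m < n) cholesky K i m * cholesky K j m.
Proof.
move=> Kp jn; suff : K i j =
    \sum_(m < n) cholesky K i m * cholesky K j m + residual K n i j.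
  by rewrite residual_eq0// addr0.
elim: n {jn} => [|n IH]; first by rewrite big_ord0 add0r.
rewrite IH big_ord_recr/= -addrA; congr (_ + _).
rewrite /cholesky mulf_div -expr2 sqr_sqrtr; first by rewrite addrC subrK.
by apply: psd_diag_ge0; exact: residual_psd.
Qed.

(** Schur product theorem: on finitely many points, [K2] is a sum of kernels of
    the form [f i * f j], and multiplying [K1] by such a kernel only changes
    the weights. *)
Lemma psd_mul (T : Type) (K1 K2 : T -> T -> R) :
  psd K1 -> psd K2 -> psd (fun x y => K1 x y * K2 x y).
Proof.
move=> K1p K2p; split=> [x y|n x a]; first by rewrite K1p.1 K2p.1.
pose L := cholesky (fun i j => K2 (x i) (x j)).
have -> : quad_form (fun x y => K1 x y * K2 x y) n x a =
    \sum_(m < n) quad_form K1 n x (fun i => a i * L i m).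
  rewrite exchange_big; apply: eq_bigr => i _.
  rewrite exchange_big; apply: eq_bigr => j _.
  rewrite (choleskyE i (psd_comp x K2p) (ltn_ord j)) !mulr_sumr.
  by apply: eq_bigr => m _; rewrite -/L; ring.
by apply: sumr_ge0 => m _; exact: K1p.2.
Qed.

Lemma psd_expR (T : Type) (K : T -> T -> R) :
  psd K -> psd (fun x y => expR (K x y)).
Proof.
move=> Kp.
have pw m : psd (fun x y => K x y ^+ m).
  elim: m => [|m IH].
    by under eq_fun do under eq_fun do rewrite expr0; exact: psd_cst1.
  by under eq_fun do under eq_fun do rewrite exprS; exact: psd_mul.
apply: (@psd_lim _ (fun n x y => \sum_(m < n) (m`!%:R)^-1 * K x y ^+ m)).
  by move=> n; apply: psd_sum => m; apply: psd_scale.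
move=> x y; have := @is_cvg_series_exp_coeff R (K x y).
rewrite /expR /series /exp_coeff /=.
by under eq_fun do (rewrite big_mkord; under eq_bigr do rewrite mulrC).
Qed.

(** Schoenberg: expanding the square, the Gaussian is the exponential of a Gram
    kernel multiplied by a function of [x] and the same function of [y]. *)
Lemma psd_gaussian (T : Type) (V : completeNormedModType R) (F : T -> V)
    (t : R) :
  is_hilbert V -> 0 <= t -> psd (fun x y => expR (- (t * `|F x - F y| ^+ 2))).
Proof.
move=> [ip ipE] t0.
have ipC u v : ip u v = ip v u.
  by have := @hermitian_subproof _ _ _ _ ip u v; rewrite expr0 mul1r.
have ipZl c u v : ip (c *: u) v = c * ip u v by exact: linearZl_LR.
have ipZr c u v : ip u (c *: v) = c * ip u v by rewrite ipC ipZl ipC.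
have gram : psd (fun x y => ip (F x) (F y)).
  split=> [x y|n x a]; first exact: ipC.
  suff -> : quad_form (fun x y => ip (F x) (F y)) n x a =
    `|\sum_(i < n) a i *: F (x i)| ^+ 2 by exact: sqr_ge0.
  rewrite ipE linear_sumlz; apply: eq_bigr => i _.
  rewrite linear_sumr; apply: eq_bigr => j _.
  rewrite -mulrA; apply/esym.
  exact: etrans (ipZl _ _ _) (congr1 ( *%R (a i)) (ipZr _ _ _)).
have -> : (fun x y => expR (- (t * `|F x - F y| ^+ 2))) =
   (fun x y => expR (- (t * `|F x| ^+ 2)) * expR (- (t * `|F y| ^+ 2)) *
      expR (2 * t * ip (F x) (F y))).
  apply/funext => x; apply/funext => y; rewrite -!expRD; congr expR.
  rewrite !ipE linearBl !linearBr /= (ipC (F y) (F x)); ring.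
apply: psd_weight; apply: psd_expR; apply: psd_scale => //.
by rewrite mulr_ge0.
Qed.

(** The vectors are the rows of the Cholesky factor.  Their inner products are
    finite sums, since the factor is lower triangular. *)
Lemma psd_realize (K : nat -> nat -> R) : psd K ->
  exists v : nat -> hilbert_seq R, forall i j, hdot (v i) (v j) = K i j.
Proof.
move=> Kp.
have Lsum i j n : (j < n)%N ->
    \sum_(m < n) cholesky K i m * cholesky K j m = K i j.
  by move=> jn; rewrite -(choleskyE i Kp jn).
have sP i : cholesky K i \in @is_sq_summable R.
  apply/sq_summableP; exists (K i i) => n.
  rewrite -(Lsum i i (maxn n i.+1)) ?leq_max ?leqnn ?orbT//.
  by apply: sq_sum_nondecreasing; exact: leq_maxl.
exists (fun i => HilbertSeq (sP i)) => i j.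
apply/cvg_lim => //; apply: cvg_near_cst.
by exists j.+1 => // n /= jn; exact: Lsum.
Qed.

End PositiveKernels.

(** * From kernels to coarse embeddings *)

Section CoarseEmbeddingFromKernels.
Local Open Scope classical_set_scope.
Variable R : realType.

Lemma normalized_psd_norm_le1 (T : Type) (K : T -> T -> R) x y :
  psd K -> (forall z, K z z = 1) -> `|K x y| <= 1.
Proof.
move=> Kp K1; have h t := quad_form_rcons 1 (fun=> x) (fun=> 1) y t Kp.
rewrite /quad_form in h.
have {}h t : 0 <= 1 + 2 * t * K x y + t ^+ 2.
  by have := h t; rewrite !big_ord1 !K1 !mul1r mulr1.
have := h 1; have := h (-1); rewrite ler_norml; lra.
Qed.

(** For a Gram kernel [K x y] = <v_x, v_y> this is the Gram kernel of the
    vectors v_x - v_o.  In general, add the point [o] with minus the total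
    weight. *)
Lemma psd_based_defect (T : Type) (K : T -> T -> R) o :
  psd K -> K o o = 1 -> psd (fun x y => 1 - K x o - K y o + K x y).
Proof.
move=> Kp K1; split=> [x y|n x a]; first by rewrite (Kp.1 x y); ring.
have := quad_form_rcons n x a o (- \sum_(i < n) a i) Kp.
rewrite K1; congr (_ <= _).
pose s := \sum_(i < n) a i; pose u := \sum_(i < n) a i * K (x i) o.
suff -> : quad_form (fun x y => 1 - K x o - K y o + K x y) n x a =
   s * s - s * u - u * s + quad_form K n x a by rewrite -/s -/u; ring.
rewrite /quad_form /s /u !mulr_suml -!sumrB -big_split/=; apply: eq_bigr => i _.
rewrite !mulr_sumr -!sumrB -big_split/=; apply: eq_bigr => j _; ring.
Qed.

Variables (T : countType) (o : T) (d : T -> T -> R) (K : nat -> T -> T -> R).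
Hypothesis d_ge0 : forall x y, 0 <= d x y.
Hypothesis K_psd : forall n, psd (K n).
Hypothesis K_norm : forall n x, K n x x = 1.
Hypothesis K_close : forall n x y, d x y <= n%:R -> 1 - K n x y <= 2^-1 ^+ n.
Hypothesis K_far : forall n,
  exists r, forall x y, r <= d x y -> K n x y <= 2^-1.

Let defect x y n := \sum_(m < n) (1 - K m x y).

Let K_le1 n x y : K n x y <= 1.
Proof.
exact: le_trans (ler_norm _) (normalized_psd_norm_le1 x y (K_psd n) (K_norm n)).
Qed.

Let defect_nd x y : nondecreasing_seq (defect x y).
Proof.
apply/nondecreasing_seqP => n; rewrite /defect big_ord_recr/= lerDl.
by rewrite subr_ge0 K_le1.
Qed.

(* The first d(x, y) + 1 defects are at most 2 each, the n-th of the others at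
   most 2^-n; the subtracted power of 1/2 makes the induction go through. *)
Let defect_le x y n : defect x y n <= 2 * d x y + 4.
Proof.
pose M := (Num.truncn (d x y)).+1.
have dM : d x y <= M%:R by apply/ltW; exact: truncnS_gt.
have Md : M%:R <= d x y + 1 by rewrite -natr1 lerD2r truncn_le.
suff : defect x y n <= 2 * (minn n M)%:R + 2 - 2 * 2^-1 ^+ n.
  have : (minn n M)%:R <= M%:R :> R by rewrite ler_nat geq_minr.
  have : 0 <= 2^-1 ^+ n :> R by rewrite exprn_ge0.
  lra.
elim: n => [|n IH]; first by rewrite /defect big_ord0 min0n expr0; lra.
rewrite /defect big_ord_recr/= exprS.
have e0 : 0 <= 2^-1 ^+ n :> R by rewrite exprn_ge0.
rewrite -/(defect x y n); have [nM|Mn] := ltnP n M.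
  move: IH; rewrite (minn_idPl nM) (minn_idPl (ltnW nM)) -[n.+1%:R]natr1.
  have := normalized_psd_norm_le1 x y (K_psd n) (K_norm n).
  by rewrite ler_norml => /andP[]; lra.
move: IH; rewrite (minn_idPr Mn) (minn_idPr (leqW Mn)).
have : d x y <= n%:R by rewrite (le_trans dM)// ler_nat.
by move=> /K_close; lra.
Qed.

Let N x y := limn (defect x y).

Let defect_cvg x y : (defect x y) @ \oo --> N x y.
Proof.
apply: nondecreasing_is_cvgn; first exact: defect_nd.
by exists (2 * d x y + 4) => _ [n _ <-]; exact: defect_le.
Qed.

Let N_le x y : N x y <= 2 * d x y + 4.
Proof.
by apply: (cvgr_to_le (@defect_cvg x y)); apply: nearW => n; exact: defect_le.
Qed.

Let defect_le_N x y n : defect x y n <= N x y.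
Proof. exact: (nondecreasing_cvgn_le (defect_nd x y) (@defect_cvg x y)). Qed.

Let N_diag x : N x x = 0.
Proof.
apply/cvg_lim => //.
have -> : defect x x = fun=> 0.
  by apply/funext => n; rewrite /defect big1// => m _; rewrite K_norm subrr.
exact: cvg_cst.
Qed.

(* N is conditionally negative definite: the kernel G based at o is positive
   semidefinite, and in a Gram realization of G the squared distances are N. *)
Let N_realize : exists F : T -> hilbert_seq R,
  forall x y, `|F x - F y| ^+ 2 = N x y.
Proof.
pose G x y := 2^-1 * (N x o + N y o - N x y).
have Gp : psd G.
  apply: psd_scale => //.
  apply: (@psd_lim _ _
      (fun n x y => defect x o n + defect y o n - defect x y n)).
    move=> n.
    have -> : (fun x y => defect x o n + defect y o n - defect x y n) =
        (fun x y => \sum_(m < n) (1 - K m x o - K m y o + K m x y)).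
      apply/funext => x; apply/funext => y.
      rewrite /defect -big_split -sumrB; apply: eq_bigr => m _ /=; ring.
    by apply: psd_sum => m; exact: psd_based_defect.
  move=> x y; apply: cvgB; last exact: defect_cvg.
  by apply: cvgD; exact: defect_cvg.
have [v vE] := psd_realize (psd_comp (fun n => odflt o (unpickle n)) Gp).
exists (fun x => v (pickle x)) => x y.
rewrite sqr_hnorm.
have -> : v (pickle x) - v (pickle y) = v (pickle x) + (-1) *: v (pickle y).
  by rewrite scaleN1r.
rewrite !(hdotDl, hdotDr, hdotZl, hdotZr) !vE !pickleK /= /G !N_diag.
have -> : N y x = N x y.
  by rewrite /N /defect; under eq_fun do under eq_bigr do rewrite (K_psd _).1.
lra.
Qed.

(* Each m with tau m <= d x y contributes at least 1/2 to N x y.  Counting only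
   the m up to t keeps the sum finite; every fixed m is counted eventually. *)
Let count (tau : nat -> R) (t : R) : R :=
  \sum_(m < (Num.truncn t).+1) (tau m <= t)%R%:R.

Let count_ge (tau : nat -> R) n t : (n <= (Num.truncn t).+1)%N ->
  \sum_(m < n) (tau m <= t)%R%:R <= count tau t.
Proof.
move=> nt; rewrite /count -!(big_mkord predT (fun m => (tau m <= t)%R%:R)).
rewrite [leRHS](big_cat_nat (n := n))//= lerDl.
by apply: sumr_ge0.
Qed.

Let count_le_N (tau : nat -> R) x y :
  (forall n x y, tau n <= d x y -> K n x y <= 2^-1) ->
  2^-1 * count tau (d x y) <= N x y.
Proof.
move=> tauP; apply: le_trans (defect_le_N x y (Num.truncn (d x y)).+1).
rewrite mulr_sumr; apply: ler_sum => m _.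
case: (boolP (tau m <= d x y)) => [/tauP|_]; first by rewrite mulr1; lra.
by rewrite mulr0 subr_ge0 K_le1.
Qed.

(** The squared distances N of the realization lie between half the number of
    kernels that are already small at distance [d x y] and a linear function
    of [d x y]. *)
Lemma kernels_coarse_embedding : embeds_coarsely_in_hilbert d.
Proof.
have [F FN] := N_realize.
exists (hilbert_seq R : completeNormedModType R), F; split.
  exact: hilbert_seq_hilbert.
have [tau tauP] := choice K_far.
pose rho_m t := Num.sqrt (2^-1 * count tau t).
(* for t >= 0, 2 t + 4 is at least 1, so it bounds its own square root *)
pose rho_p t : R := 2 * t + 4.
exists rho_m, rho_p; split=> [rho [->|->]|x y].
- split=> [t _|s t s0 st|].
  + exact: sqrtr_ge0.
  + apply: ler_wsqrtr; rewrite ler_pM2l// /count.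
    have st' : ((Num.truncn s).+1 <= (Num.truncn t).+1)%N.
      by rewrite ltnS le_truncn.
    apply: le_trans (count_ge tau st').
    apply: ler_sum => m _; case: (leP (tau m) s) => // ms.
    by rewrite (le_trans ms st).
  + apply/cvgryPge => A.
    pose n := (Num.truncn (2 * A ^+ 2)).+1.
    near=> t; apply: le_trans (ler_norm A) _.
    rewrite -sqrtr_sqr; apply: ler_wsqrtr.
    have nt : n%:R <= t by near: t; apply: nbhs_pinfty_ge; rewrite num_real.
    have tau_le m : (m < n)%N -> tau m <= t.
      move=> mn; apply: le_trans (ler_norm _) _.
      have st : \sum_(k < n) `|tau k| <= t.
        by near: t; apply: nbhs_pinfty_ge; rewrite num_real.
      apply: le_trans st; rewrite (bigD1 (Ordinal mn))//= lerDl.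
      by apply: sumr_ge0.
    have : n%:R <= count tau t.
      have nt' : (n <= (Num.truncn t).+1)%N.
        by rewrite leqW// truncn_ge_nat// (le_trans _ nt).
      apply: le_trans (count_ge tau nt').
      rewrite (eq_bigr (fun=> 1)); first by rewrite sumr_const card_ord.
      by move=> m _; rewrite tau_le.
    have : 2 * A ^+ 2 < n%:R by exact: truncnS_gt.
    lra.
- split=> [t t0|s t s0 st|].
  + by rewrite /rho_p; lra.
  + by rewrite /rho_p; lra.
  + apply/cvgryPge => A; near=> t; rewrite /rho_p.
    have : A <= t by near: t; apply: nbhs_pinfty_ge; rewrite num_real.
    have : 0 <= t by near: t; apply: nbhs_pinfty_ge; rewrite num_real.
    lra.
- have d0 := d_ge0 x y.
  apply/andP; split.
    rewrite -(@ler_pXn2r _ 2) ?nnegrE ?sqrtr_ge0// FN sqr_sqrtr.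
      exact: count_le_N.
    by rewrite mulr_ge0//; apply: sumr_ge0.
  rewrite -(@ler_pXn2r _ 2) ?nnegrE// /rho_p; last lra.
  rewrite FN (le_trans (N_le x y))//; nra.
Unshelve. all: by end_near. Qed.

End CoarseEmbeddingFromKernels.

(** * Word metrics and disjoint unions *)

Section WordMetric.
Variables (gT : finGroupType) (S : {set gT}).
Hypothesis S_gen : <<S>>%g = [set: gT]%SET.
Local Open Scope group_scope.
Implicit Types a b g h : gT.

Lemma mem_word_length g : g \in (S :|: S^-1) ^+ word_length S g.
Proof.
rewrite /word_length; case: ex_minnP => n.
by rewrite /word_reach S_gen inE.
Qed.

Lemma word_length_min g n : g \in (S :|: S^-1) ^+ n -> (word_length S g <= n)%N.
Proof.
move=> gn; rewrite /word_length; case: ex_minnP => m _; apply.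
by rewrite /word_reach gn implybT.
Qed.

Lemma word_lengthM g h :
  (word_length S (g * h) <= word_length S g + word_length S h)%N.
Proof.
apply: word_length_min; rewrite expgD.
by apply: mem_mulg; exact: mem_word_length.
Qed.

Lemma word_lengthV g : word_length S g^-1 = word_length S g.
Proof.
have memV n x : x \in (S :|: S^-1) ^+ n -> x^-1 \in (S :|: S^-1) ^+ n.
  elim: n x => [|n IH] x; first by rewrite !expg0 !inE invg_eq1.
  rewrite {1}expgS expgSr => /mulsgP[s y sS yS ->].
  rewrite invMg mem_mulg ?IH//.
  by move: sS; rewrite !inE invgK orbC.
apply/eqP; rewrite eqn_leq; apply/andP; split.
  by apply: word_length_min; apply: memV; exact: mem_word_length.
rewrite -{1}[g]invgK; apply: word_length_min.
by apply: memV; exact: mem_word_length.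
Qed.

Lemma word_distC a b : word_dist S a b = word_dist S b a.
Proof. by rewrite /word_dist -word_lengthV invMg invgK. Qed.

Lemma word_dist_triangle a b g :
  (word_dist S a g <= word_dist S a b + word_dist S b g)%N.
Proof.
rewrite /word_dist; apply: leq_trans (word_lengthM _ _).
by rewrite -!mulgA mulKVg.
Qed.

Lemma word_distMl g a b : word_dist S (g * a) (g * b) = word_dist S a b.
Proof. by rewrite /word_dist invMg -mulgA mulKg. Qed.

Lemma word_dist_diam a b : (word_dist S a b <= word_diam S)%N.
Proof.
rewrite /word_diam; apply: leq_trans (leq_bigmax a).
exact: (leq_bigmax b).
Qed.

End WordMetric.

Section UnionMetric.
Variable R : realType.
Variables (X : nat -> Type) (e : forall i, X i) (d : forall i, X i -> X i -> R).
Arguments d : clear implicits.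
Variable c : nat -> R.
Hypothesis dC : forall i a b, d i a b = d i b a.
Hypothesis d_ge0 : forall i a b, 0 <= d i a b.
Hypothesis c_ge0 : forall i, 0 <= c i.
Local Notation D := (union_dist e d c).

Definition component_offset (i : nat) : R := \sum_(0 <= k < i) c k.

Lemma component_offsetB i j : (i <= j)%N ->
  component_offset j - component_offset i = \sum_(i <= k < j) c k.
Proof.
move=> ij; rewrite /component_offset (big_cat_nat (n := i))//=.
by rewrite addrAC subrr add0r.
Qed.

Lemma union_dist_same i a b : D (Tagged X a) (Tagged X b) = d i a b.
Proof. by rewrite /union_dist /= eqxx tagged_asE. Qed.

(** Placing the base points on a line, at their offsets, makes the formula
    symmetric in the two components; the triangle inequality across components
    then comes from the one on the line. *)
Lemma union_dist_diff u v : tag u != tag v -> D u v =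
  d (tag u) (tagged u) (e _) + d (tag v) (tagged v) (e _) +
  `|component_offset (tag u) - component_offset (tag v)|.
Proof.
move=> uv; rewrite /union_dist (negPf uv).
case: ltnP => [ltuv|levu].
  rewrite distrC component_offsetB ?(ltnW ltuv)// ger0_norm ?sumr_ge0//.
  by rewrite [d (tag v) (e _) _]dC addrAC.
rewrite component_offsetB// ger0_norm ?sumr_ge0//.
rewrite [d (tag u) (e _) _]dC; ring.
Qed.

Lemma union_distC u v : D u v = D v u.
Proof.
have [uv|uv] := eqVneq (tag u) (tag v); last first.
  rewrite !union_dist_diff// 1?eq_sym// distrC.
  by congr (_ + _); rewrite addrC.
case: u v uv => i a [j b] /= ij; case: j / ij b => b.
by rewrite !union_dist_same dC.
Qed.

Lemma union_dist_ge0 u v : 0 <= D u v.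
Proof.
have [uv|uv] := eqVneq (tag u) (tag v); last first.
  by rewrite union_dist_diff// !addr_ge0.
case: u v uv => i a [j b] /= ij; case: j / ij b => b.
by rewrite union_dist_same.
Qed.

Hypothesis d_triangle : forall i a b g, d i a g <= d i a b + d i b g.

Lemma union_dist_triangle u w v : D u v <= D u w + D w v.
Proof.
case: u v w => i a [j b] [k g].
have [ij|ij] := eqVneq i j; have [ik|ik] := eqVneq i k.
- case: j / ij b => b; case: k / ik g => g.
  by rewrite !union_dist_same; exact: d_triangle.
- case: j / ij b => b.
  rewrite union_dist_same !union_dist_diff//= 1?eq_sym//.
  have := d_triangle a (e i) b; rewrite (dC (e i)).
  have := d_ge0 g (e k).
  have := normr_ge0 (component_offset i - component_offset k).
  have := normr_ge0 (component_offset k - component_offset i); lra.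
- case: k / ik g => g.
  rewrite union_dist_same !union_dist_diff//=.
  by have := d_triangle a g (e i); lra.
- have [jk|jk] := eqVneq j k.
    case: k / jk ik g => ik g.
    rewrite union_dist_same !union_dist_diff//=.
    by have := d_triangle b g (e j); rewrite (dC b g); lra.
  rewrite !union_dist_diff//= 1?eq_sym//.
  have := ler_distD (component_offset k) (component_offset i)
    (component_offset j).
  have := d_ge0 g (e k); lra.
Qed.

End UnionMetric.

(** * Finitely supported sums *)

Section FiniteSupport.
Local Open Scope classical_set_scope.
Variables (R : realType) (Y : choiceType).

Lemma fsum_seq (F : Y -> R) (s : seq Y) : uniq s ->
  (forall y, F y != 0 -> y \in s) ->
  \sum_(y \in [set: Y]) F y = \sum_(y <- s) F y.
Proof.
move=> us Fs; rewrite (fsbigE s)//.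
  by rewrite big_mkcond; apply: eq_bigr => y _; rewrite in_setT.
by move=> y _; apply: contraNeq; exact: Fs.
Qed.

Lemma esum_seq (a : Y -> \bar R) (s : seq Y) : uniq s ->
  (forall y, 0 <= a y)%E -> (forall y, a y != 0%E -> y \in s) ->
  esum [set: Y] a = (\sum_(y <- s) a y)%E.
Proof.
move=> us a0 as_.
have -> : esum [set: Y] a = esum [set` s] a.
  rewrite [RHS]esum_mkcond; apply: eq_esum => y _.
  case: ifPn => // ys; apply/eqP; apply: contraNT ys => /as_ ys.
  by rewrite inE.
rewrite fsbig_seq//; apply: esum_fset => [|y _]; [exact: finite_seq|exact: a0].
Qed.

(** With property A and bounded geometry every function [phi x] has finite
    support, so its inner products are finite sums. *)
Lemma ell2_dot_finite (f g : Y -> R) (s : seq Y) : uniq s ->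
  (forall y, f y * g y != 0 -> y \in s) ->
  ell2_dot f g = \sum_(y <- s) f y * g y.
Proof.
move=> us fgs; rewrite /ell2_dot.
have nz y w : maxe (f y * g y * w)%:E 0 != 0%E -> y \in s.
  move=> h; apply: fgs; apply: contra_neq h => ->.
  by rewrite mul0r maxxx.
rewrite !(@esum_seq _ s)//.
- under eq_bigr do rewrite funeposE -EFin_max.
  under [X in (_ - X)%E]eq_bigr do rewrite funenegE -EFinN -EFin_max.
  rewrite !sumEFin -EFinB /= -sumrB; apply: eq_bigr => y _.
  by rewrite /Num.max; case: ifPn; case: ifPn; rewrite ?oppr_lt0 ?oppr_gt0; lra.
- by move=> y; rewrite funenegE -EFinN -mulrN1 => /nz.
- by move=> y; rewrite funeposE -[f y * g y]mulr1 => /nz.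
Qed.

Lemma ell2_norm1_dot (f : Y -> R) : 0 <= ell2_dot f f -> ell2_norm f = 1 ->
  ell2_dot f f = 1.
Proof.
by move=> f0 f1; rewrite -[LHS]sqr_sqrtr// -/(ell2_norm f) f1 expr1n.
Qed.

End FiniteSupport.

(** * Fibering permanence *)

Section Fibering.
Local Open Scope classical_set_scope.
Variables (R : realType) (X : countType) (Y : choiceType) (Z : Type).
Variables (dX : X -> X -> R) (dY : Y -> Y -> R) (dZ : Z -> Z -> R).
Variables (p : X -> Y) (eta : X -> Y -> X) (th : X -> Y -> Z).
(* [eta u y] is a point of the fibre over [y] nearly closest to [u], and
   [th u y] is its coordinate in the model fibre [Z]. *)
Hypothesis dX_ge0 : forall u v, 0 <= dX u v.
Hypothesis dXC : forall u v, dX u v = dX v u.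
Hypothesis dX_triangle : forall u w v, dX u v <= dX u w + dX w v.
Hypothesis p_short : forall u v, dY (p u) (p v) <= dX u v.
Hypothesis eta_near : forall u y, dX u (eta u y) <= 2 * dY (p u) y + 2.
Hypothesis th_eta : forall u v y, dZ (th u y) (th v y) = dX (eta u y) (eta v y).

Lemma eta_close r S u v y : dX u v <= r -> dY (p u) y <= S -> dY (p v) y <= S ->
  dX (eta u y) (eta v y) <= r + 2 * (2 * S + 2).
Proof.
move=> uv uS vS.
have := dX_triangle (eta u y) u (eta v y); have := dX_triangle u v (eta v y).
have := eta_near u y; have := eta_near v y; rewrite (dXC (eta u y) u); lra.
Qed.

Lemma eta_far r S u v y : r + 2 * (2 * S + 2) <= dX u v ->
  dY (p u) y <= S -> dY (p v) y <= S -> r <= dX (eta u y) (eta v y).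
Proof.
move=> uv uS vS.
have := dX_triangle u (eta u y) v; have := dX_triangle (eta u y) (eta v y) v.
have := eta_near u y; have := eta_near v y; rewrite (dXC (eta v y) v); lra.
Qed.

(** Summed over [y] with [a] and [b] the values of two unit vectors of l^2, the
    right-hand side is [e]; this is how bounds on the fibre kernel become bounds
    on the total kernel. *)
Lemma mul_le_half_sq (a b w e : R) : 0 <= w -> 0 <= e ->
  (a != 0 -> b != 0 -> w <= e) -> a * b * w <= e * (2^-1 * (a ^+ 2 + b ^+ 2)).
Proof.
move=> w0 e0 we.
have q0 x y : 0 <= 2^-1 * (x ^+ 2 + y ^+ 2) :> R.
  by rewrite mulr_ge0// addr_ge0 ?sqr_ge0.
have [->|an0] := eqVneq a 0; first by rewrite !mul0r mulr_ge0 ?q0.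
have [->|bn0] := eqVneq b 0; first by rewrite mulr0 mul0r mulr_ge0 ?q0.
have ab : a * b <= 2^-1 * (a ^+ 2 + b ^+ 2) by have := sqr_ge0 (a - b); nra.
apply: le_trans (ler_wpM2r w0 ab) _.
by rewrite mulrC; apply: ler_wpM2r; [exact: q0|exact: we].
Qed.

(** The Gaussian of the embedding, with [t] so small that it is [eps]-close to
    1 at distance [D], where the image distance is bounded; then [tau] is
    chosen from the divergence of the lower control function. *)
Lemma fibre_kernel (D eps : R) : 0 < eps -> embeds_coarsely_in_hilbert dZ ->
  exists kZ : Z -> Z -> R, exists tau : R,
  [/\ psd kZ, forall a, kZ a a = 1, forall a b, 0 <= kZ a b <= 1,
      forall a b, 0 <= dZ a b -> dZ a b <= D -> 1 - kZ a b <= eps &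
      forall a b, tau <= dZ a b -> kZ a b <= 2^-1].
Proof.
move=> eps0 [V [F [Vh [rho_m [rho_p [rhoP FP]]]]]].
have [m0 m_nd m_inf] := rhoP rho_m (or_introl erefl).
have [p0 p_nd p_inf] := rhoP rho_p (or_intror erefl).
pose B := rho_p (Num.max D 0).
have B0 : 0 <= B by apply: p0; rewrite le_max lexx orbT.
have B1 : 0 < B ^+ 2 + 1 by rewrite ltr_wpDl// sqr_ge0.
pose t := eps / (B ^+ 2 + 1).
have t0 : 0 < t by rewrite divr_gt0.
have tB : t * (B ^+ 2 + 1) = eps by rewrite /t mulfVK// gt_eqF.
move/cvgryPge : m_inf => /(_ (1 + t^-1)) [M [_ M_far]].
pose tau := Num.max (M + 1) 0.
have mtau : 1 + t^-1 <= rho_m tau.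
  by apply: M_far; rewrite lt_max ltrDl ltr01.
exists (fun a b => expR (- (t * `|F a - F b| ^+ 2))), tau; split.
- by apply: psd_gaussian => //; exact: ltW.
- by move=> a; rewrite subrr normr0 expr0n mulr0 oppr0 expR0.
- move=> a b; rewrite expR_ge0 /= -expR0 ler_expR oppr_le0.
  by apply: mulr_ge0; [exact: ltW|exact: sqr_ge0].
- move=> a b ab0 abD.
  have FB : `|F a - F b| <= B.
    have /andP[_ h] := FP a b; apply: le_trans h _; apply: p_nd => //.
    by rewrite le_max abD.
  have : `|F a - F b| ^+ 2 <= B ^+ 2 by rewrite ler_pXn2r// ?nnegrE.
  have := expR_ge1Dx (- (t * `|F a - F b| ^+ 2)).
  set w := `|F a - F b| ^+ 2 => h1 h2.
  have : t * w <= t * B ^+ 2 by rewrite ler_pM2l.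
  lra.
- move=> a b tau_ab.
  (* t (1 + 1/t)^2 is at least 1, and exp 1 is at least 2 *)
  have Ft : 1 + t^-1 <= `|F a - F b|.
    have /andP[h _] := FP a b; apply: le_trans h.
    by apply: le_trans mtau _; apply: m_nd => //; rewrite le_max lexx orbT.
  have : (1 + t^-1) ^+ 2 <= `|F a - F b| ^+ 2.
    rewrite ler_pXn2r// ?nnegrE// addr_ge0// invr_ge0 ltW//.
  set w := `|F a - F b| ^+ 2 => h1.
  have : t * (1 + t^-1) ^+ 2 <= t * w by rewrite ler_pM2l.
  have -> : t * (1 + t^-1) ^+ 2 = t + 2 + t^-1 by field; rewrite gt_eqF.
  have tV0 : 0 < t^-1 by rewrite invr_gt0.
  move=> tw; have h2 : 2 <= expR (t * w).
    by apply: le_trans (expR_ge1Dx _); lra.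
  by rewrite expRN lef_pV2 ?posrE ?expR_gt0.
Qed.

(** Weighting the fibre kernels by property A of the base.  Where both weights
    are nonzero, [y] is within [S] of [p u] and [p v], so distances upstairs and
    in the fibre differ by a bounded amount. *)
Lemma total_kernel (r eps : R) : 0 < r -> 0 < eps ->
  embeds_coarsely_in_hilbert dZ -> property_A dY ->
  exists K : X -> X -> R,
  [/\ psd K, forall u, K u u = 1,
      forall u v, dX u v <= r -> 1 - K u v <= eps &
      exists tau, forall u v, tau <= dX u v -> K u v <= 2^-1].
Proof.
move=> r0 eps0 Zemb [Ybg YA].
have eps20 : 0 < eps / 2 by rewrite divr_gt0.
have [S [phi [S0 phi1 phi_close phi_supp]]] := YA r (eps / 2) r0 eps20.
have [kZ [tau [kZ_psd kZ1 kZ01 kZ_close kZ_far]]] :=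
  fibre_kernel (r + 2 * (2 * S + 2)) eps20 Zemb.
have [s sP] : exists s : Y -> seq Y, forall y,
    uniq (s y) /\ forall z, phi y z != 0 -> z \in s y.
  have [N NP] := Ybg S.
  have [s sP] := choice NP.
  exists (fun y => undup (s y)) => y; split; first exact: undup_uniq.
  move=> z /phi_supp yz; rewrite mem_undup; exact: (sP y).2.
have phiE u v L : uniq L -> {subset s (p u) <= L} ->
    ell2_dot (phi (p u)) (phi (p v)) = \sum_(y <- L) phi (p u) y * phi (p v) y.
  move=> uL sL; apply: ell2_dot_finite => // y; rewrite mulf_eq0 negb_or.
  by move=> /andP[/(sP _).2 /sL].
have phi_sq u L : uniq L -> {subset s (p u) <= L} ->
    \sum_(y <- L) phi (p u) y ^+ 2 = 1.
  move=> uL sL; have := phiE u u L uL sL => phiuu.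
  rewrite -[LHS]phiuu; apply: ell2_norm1_dot; last exact: (phi1 _).2.
  by rewrite phiuu; apply: sumr_ge0 => y _; rewrite -expr2 sqr_ge0.
pose term u v y := phi (p u) y * phi (p v) y * kZ (th u y) (th v y).
pose K u v := \sum_(y \in [set: Y]) term u v y.
have KE u v L : uniq L -> {subset s (p u) <= L} ->
    K u v = \sum_(y <- L) term u v y.
  move=> uL sL; apply: fsum_seq => // y; rewrite /term !mulf_eq0 !negb_or.
  by move=> /andP[/andP[/(sP _).2 /sL]].
have common u v : exists L,
    [/\ uniq L, {subset s (p u) <= L} & {subset s (p v) <= L}].
  exists (undup (s (p u) ++ s (p v))); split; first exact: undup_uniq.
    by move=> y yu; rewrite mem_undup mem_cat yu.
  by move=> y yv; rewrite mem_undup mem_cat yv orbT.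
have term_psd y : psd (fun u v => term u v y).
  apply: (psd_weight (fun u => phi (p u) y)).
  exact: (psd_comp (fun u => th u y) kZ_psd).
exists K; split.
- split=> [u v|n x a].
    by rewrite /K; apply: eq_fsbigr => y _; exact: (term_psd y).1.
  pose L := undup (flatten [seq s (p (x i)) | i <- iota 0 n]).
  have KL (i j : 'I_n) : K (x i) (x j) = \sum_(y <- L) term (x i) (x j) y.
    apply: KE; first exact: undup_uniq.
    move=> y yi; rewrite mem_undup; apply/flattenP; exists (s (p (x i))) => //.
    by apply: map_f; rewrite mem_iota ltn_ord.
  rewrite /quad_form; under eq_bigr do under eq_bigr do rewrite KL.
  exact: (psd_sum L term_psd).2.
- move=> u; have us := (sP (p u)).1.
  rewrite (KE u u _ us)// -(phi_sq u _ us)//.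
  by apply: eq_bigr => y _; rewrite /term kZ1 mulr1.
- move=> u v uv; have [L [uL uLs vLs]] := common u v.
  have := phi_close (p u) (p v) (le_trans (p_short u v) uv).
  rewrite (phiE u v L)// (KE u v L)// => /(le_trans (ler_norm _)) h.
  have -> : eps = eps / 2 + \sum_(y <- L) eps / 2 *
      (2^-1 * (phi (p u) y ^+ 2 + phi (p v) y ^+ 2)).
    by rewrite -mulr_sumr -mulr_sumr big_split/= !phi_sq//; field.
  suff : \sum_(y <- L) phi (p u) y * phi (p v) y - \sum_(y <- L) term u v y <=
      \sum_(y <- L) eps / 2 * (2^-1 * (phi (p u) y ^+ 2 + phi (p v) y ^+ 2)).
    lra.
  rewrite -sumrB; apply: ler_sum => y _; rewrite /term.
  have /andP[k0 k1] := kZ01 (th u y) (th v y).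
  rewrite -{1}[_ * _]mulr1 -mulrBr; apply: mul_le_half_sq; [lra|exact: ltW|].
  move=> /phi_supp uy /phi_supp vy; apply: kZ_close; rewrite th_eta//.
  exact: eta_close.
- exists (tau + 2 * (2 * S + 2)) => u v uv.
  have [L [uL uLs vLs]] := common u v.
  rewrite (KE u v L)//.
  have -> : 2^-1 = \sum_(y <- L) 2^-1 *
      (2^-1 * (phi (p u) y ^+ 2 + phi (p v) y ^+ 2)).
    by rewrite -mulr_sumr -mulr_sumr big_split/= !phi_sq//; field.
  apply: ler_sum => y _; rewrite /term.
  have /andP[k0 k1] := kZ01 (th u y) (th v y).
  apply: mul_le_half_sq => // /phi_supp uy /phi_supp vy.
  by apply: kZ_far; rewrite th_eta; exact: eta_far uv uy vy.
Qed.

Lemma fibering_coarse_embedding (o : X) :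
  embeds_coarsely_in_hilbert dZ -> property_A dY ->
  embeds_coarsely_in_hilbert dX.
Proof.
move=> Zemb YA.
have e0 n : 0 < 2^-1 ^+ n :> R by rewrite exprn_gt0.
have KP n := total_kernel (ltr0Sn R n) (e0 n) Zemb YA.
have [K {}KP] := choice KP.
apply: (@kernels_coarse_embedding _ _ o _ K) => //.
- by move=> n; have [] := KP n.
- by move=> n u; have [_ ->] := KP n.
- move=> n u v uv; have [_ _ h _] := KP n; apply: h.
  by apply: le_trans uv _; rewrite ler_nat.
- by move=> n; have [_ _ _] := KP n.
Qed.

End Fibering.

(** * Quotient metrics and box spaces *)

Section QuotientMetric.
Local Open Scope classical_set_scope.
Variables (R : realType) (gT qT : finGroupType) (S : {set gT}).
Variable pi : {morphism [set: gT]%SET >-> qT}.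
Hypothesis S_gen : <<S>>%g = [set: gT]%SET.
Hypothesis pi_surj : (pi @* [set: gT]%SET)%g = [set: qT]%SET.

Definition word_metric (a b : gT) : R := (word_dist S a b)%:R.
Local Notation d := word_metric.
Local Notation q := (quotient_dist pi d).

Lemma surj_lift y : exists a, pi a = y.
Proof.
have : y \in (pi @* [set: gT]%SET)%g by rewrite pi_surj inE.
by case/morphimP => a _ _ ->; exists a.
Qed.

Let dists y y' := [set r | exists a b, [/\ pi a = y, pi b = y' & r = d a b]].

Lemma has_inf_dists y y' : has_inf (dists y y').
Proof.
have [a ay] := surj_lift y; have [b by'] := surj_lift y'.
split; first by exists (d a b), a, b.
by exists 0 => _ [a' [b' [_ _ ->]]].
Qed.

Lemma quotient_dist_le a b : q (pi a) (pi b) <= d a b.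
Proof.
apply: ge_inf; last by exists a, b.
exact: (has_inf_dists _ _).2.
Qed.

Lemma quotient_dist_ge0 y y' : 0 <= q y y'.
Proof.
apply: lb_le_inf; first exact: (has_inf_dists _ _).1.
by move=> _ [a [b [_ _ ->]]].
Qed.

Lemma quotient_distC y y' : q y y' = q y' y.
Proof.
rewrite /quotient_dist; congr inf.
by apply/seteqP; split=> _ [a [b [ay b' ->]]] /=; exists b, a;
  rewrite /word_metric word_distC.
Qed.

(** Left invariance allows a nearly optimal pair of representatives to be
    translated so that its first entry is [a].  The extra 1 makes do with an
    infimum that need not be attained. *)
Lemma quotient_dist_lift a y : exists b, pi b = y /\ d a b <= q (pi a) y + 1.
Proof.
have [_ [a' [b' [a'a b'y ->]]] /ltW ab] :=
  inf_adherent (@ltr01 R) (has_inf_dists (pi a) y).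
exists (a * (a'^-1 * b'))%g; split.
  by rewrite !morphM ?inE// morphV ?inE// a'a b'y mulKVg.
suff -> : d a (a * (a'^-1 * b'))%g = d a' b' by [].
rewrite /word_metric -(word_distMl S a'^-1 a') mulVg.
by rewrite -[in RHS](word_distMl S a) mulg1.
Qed.

End QuotientMetric.

Section BoxSpace.
Variables (R : realType) (H Gam G : nat -> finGroupType).
Variables (iota : forall i, {morphism [set: H i]%SET >-> Gam i}).
Variables (pi : forall i, {morphism [set: Gam i]%SET >-> G i}).
Hypothesis exact_i : forall i, short_exact (iota i) (pi i).
Variable gS : forall i, {set Gam i}.
Hypothesis gS_gen : forall i, <<gS i>>%g = [set: Gam i]%SET.
Variable c : nat -> R.
Hypothesis c_large : forall i,
  (maxn (word_diam (gS i)) (word_diam (gS i.+1)))%:R < c i.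

Local Notation d i := (@word_distR R Gam gS i).
Local Notation dX := (dGam gS c).
Local Notation dY := (dG pi gS c).

Let c_ge0 i : 0 <= c i.
Proof. by apply: le_trans (ltW (c_large i)). Qed.

Let dC i a b : d i a b = d i b a.
Proof. by rewrite /word_distR word_distC. Qed.

Let d_triangle i a b g : d i a g <= d i a b + d i b g.
Proof. by rewrite /word_distR -natrD ler_nat word_dist_triangle. Qed.

Let pi_surj i : (pi i @* [set: Gam i]%SET)%g = [set: G i]%SET.
Proof. by have [] := exact_i i. Qed.

Let qC i y y' :
  quotient_dist (pi i) (d i) y y' = quotient_dist (pi i) (d i) y' y.
Proof. exact: quotient_distC. Qed.

Let q_ge0 i y y' : 0 <= quotient_dist (pi i) (d i) y y'.
Proof. by apply: quotient_dist_ge0; exact: pi_surj. Qed.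

Let q_lift i a y : exists b, pi i b = y /\
  d i a b <= quotient_dist (pi i) (d i) (pi i a) y + 1.
Proof. exact: (quotient_dist_lift R (gS i) (pi_surj i)). Qed.

Lemma box_dist_ge0 u v : 0 <= dX u v.
Proof. exact: union_dist_ge0. Qed.

Lemma box_distC u v : dX u v = dX v u.
Proof. exact: union_distC. Qed.

Lemma box_dist_triangle u w v : dX u v <= dX u w + dX w v.
Proof. exact: union_dist_triangle. Qed.

Definition box_proj (u : {i & Gam i}) : {i & G i} :=
  Tagged G (pi (tag u) (tagged u)).

(** On either side of a component, the gap to the next one exceeds the diameter
    of the component. *)
Lemma diam_le_offset i j : i != j ->
  (word_diam (gS i))%:R <= `|component_offset c i - component_offset c j|.
Proof.
move=> ij; have [lt_ij|] := ltnP i j.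
  rewrite distrC component_offsetB ?(ltnW lt_ij)// ger0_norm ?sumr_ge0//.
  rewrite big_ltn//; apply: ler_wpDr; first by rewrite sumr_ge0.
  by apply: le_trans (ltW (c_large i)); rewrite ler_nat leq_maxl.
rewrite leq_eqVlt eq_sym (negPf ij) /= => lt_ji.
rewrite component_offsetB ?(ltnW lt_ji)// ger0_norm ?sumr_ge0//.
case: i lt_ji {ij} => // i; rewrite ltnS => le_ji.
rewrite big_nat_recr//=; apply: ler_wpDl; first by rewrite sumr_ge0.
by apply: le_trans (ltW (c_large i)); rewrite ler_nat leq_maxr.
Qed.

Lemma box_proj_short u v : dY (box_proj u) (box_proj v) <= dX u v.
Proof.
case: u v => i a [j b]; rewrite /dG /dGam.
have [ij|ij] := eqVneq i j.
  case: j / ij b => b; rewrite !union_dist_same.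
  by apply: quotient_dist_le; exact: pi_surj.
rewrite !union_dist_diff//= -!(morph1 (pi _)); apply: lerD => //.
by apply: lerD; apply: quotient_dist_le; exact: pi_surj.
Qed.

(** Within a component this is [quotient_dist_lift].  Across components, the
    path runs through the identity; the length of [u] is bounded by the gap,
    which is counted twice on the right. *)
Lemma box_near_fibre u (x : {i & G i}) : exists b : Gam (tag x),
  pi _ b = tagged x /\ dX u (Tagged Gam b) <= 2 * dY (box_proj u) x + 2.
Proof.
case: u x => i a [j y]; rewrite /dG /dGam /=.
have [ij|ij] := eqVneq i j.
  case: j / ij y => y.
  have [b [by_ ab]] := q_lift a y.
  exists b; split=> //; rewrite !union_dist_same /=.
  by have := q_ge0 (pi i a) y; lra.
have [b [by_ ab]] := q_lift 1%g y.
exists b; split=> //; rewrite !union_dist_diff//=.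
have ai : d i a 1%g <= `|component_offset c i - component_offset c j|.
  by apply: le_trans (diam_le_offset ij); rewrite ler_nat word_dist_diam.
have := q_ge0 (pi i a) 1%g; have := q_ge0 1%g y.
by move: ab; rewrite morph1 (dC b) (qC y); lra.
Qed.

(** The fibre over [x] is the coset of the kernel through the chosen lift
    [sigma x], and translating by [sigma x] is an isometry from the kernel. *)
Lemma box_fibre_coordinates :
  exists (eta : {i & Gam i} -> {i & G i} -> {i & Gam i})
         (th : {i & Gam i} -> {i & G i} -> {i & H i}),
  (forall u y, dX u (eta u y) <= 2 * dY (box_proj u) y + 2) /\
  (forall u v y, dH iota gS c (th u y) (th v y) = dX (eta u y) (eta v y)).
Proof.
have lift (x : {i & G i}) : exists a, pi (tag x) a = tagged x.
  exact: surj_lift.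
pose sigma x := sval (cid (lift x)).
have sigmaE x : pi (tag x) (sigma x) = tagged x := svalP (cid (lift x)).
have near u (x : {i & G i}) : exists h : H (tag x),
    dX u (Tagged Gam (sigma x * iota _ h)%g) <= 2 * dY (box_proj u) x + 2.
  have [b [bx ub]] := box_near_fibre u x.
  have : ((sigma x)^-1 * b)%g \in ('ker (pi (tag x)))%g.
    by apply/kerP; rewrite ?inE// morphM ?inE// morphV ?inE// sigmaE bx mulVg.
  have [_ <- _] := exact_i (tag x).
  case/morphimP => h _ _ bh; exists h.
  by rewrite -bh mulKVg.
pose hh u x := sval (cid (near u x)).
exists (fun u x => Tagged Gam (sigma x * iota _ (hh u x))%g).
exists (fun u x => Tagged H (hh u x)).
split=> [u x|u v x]; first exact: (svalP (cid (near u x))).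
by rewrite /dH /dGam !union_dist_same /word_distR word_distMl.
Qed.

End BoxSpace.

Theorem theorem10 (R : realType) (H Gam G : nat -> finGroupType)
    (iota : forall i, {morphism [set: H i] >-> Gam i})
    (pi : forall i, {morphism [set: Gam i] >-> G i})
    (exact_i : forall i, short_exact (iota i) (pi i))
    (gS : forall i, {set Gam i})
    (gS_gen : forall i, <<gS i>>%g = [set: Gam i])
    (gS_bounded : exists N : nat, forall i, (#|gS i| <= N)%N)
    (diam_incr : forall i j, (i < j)%N ->
       (word_diam (gS i) < word_diam (gS j))%N)
    (c : nat -> R)
    (c_large : forall i,
       (maxn (word_diam (gS i)) (word_diam (gS i.+1)))%:R < c i) :
  embeds_coarsely_in_hilbert (dH iota gS c) ->
  property_A (dG pi gS c) ->
  embeds_coarsely_in_hilbert (dGam gS c).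
Proof.
have [eta [th [eta_near th_eta]]] :=
  box_fibre_coordinates exact_i gS_gen c_large.
apply: (fibering_coarse_embedding _ _ _ _ eta_near th_eta).
- exact: box_dist_ge0.
- exact: box_distC.
- exact: box_dist_triangle.
- exact: box_proj_short.
- exact: (Tagged Gam (1%g : Gam 0%N)).
Qed.
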